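(* For all integers $b\ge 2$ and $k\ge 1$, $$d_b\Big(\frac{b^k-1}{b-1}\Big)=d_b(\underbrace{11\ldots1}_{k}|_b)=\sum_{t=1}^{k}T(k,t)\,(b-1)^t,$$ where $T(k,t)$ is the number of compositions of $k$ into exactly $t$ parts such that no part exceeds the first part.
   Context: Nonnegative integers are written in base $b$: $n=n_{k-1}\ldots n_0|_b$ denotes $\sum_i n_ib^i$ with digits $n_i\in\{0,\ldots,b-1\}$. The dismal product of $m=m_{k-1}\ldots m_0|_b$ and $n=n_{l-1}\ldots n_0|_b$ is the number $m\otimes_b n$ whose $i$-th base $b$ digit, $0\le i\le k+l-2$, is $\max\{\min\{m_j,n_{i-j}\}:0\le j\le k-1,\ 0\le i-j\le l-1\}$. A number $p$ is a base $b$ dismal divisor of $n$ if $p\otimes_b q=n$ for some nonnegative integer $q$; $d_b(n)$ is the number of base $b$ dismal divisors of $n$ (finite for $n\ge 1$). A composition of $k$ into $t$ parts is an ordered tuple $(c_1,\ldots,c_t)$ of positive integers with sum $k$. *)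

(* Defs.v *)
(* MathComp; mathcomp-classical supplies cardinals of sets of natural numbers. *)
From mathcomp Require Import all_boot finmap.
From mathcomp Require Import classical_sets cardinality.

Set Implicit Arguments.
Unset Strict Implicit.
Unset Printing Implicit Defensive.

(* Digit sequences are listed least significant digit first. *)
Definition of_digits (b : nat) (s : seq nat) : nat :=
  \sum_(i < size s) nth 0 s i * b ^ i.

Definition digit (b n i : nat) : nat := n %/ b ^ i %% b.

(* Leading zeros do not affect the dismal product, so the canonical length is
   used; 0 is given the single digit 0. *)
Definition ndigits (b n : nat) : nat := (trunc_log b n).+1.

Lemma of_digits_digit (b n : nat) :
  1 < b -> of_digits b (mkseq (digit b n) (ndigits b n)) = n.
Proof.
move=> b1; rewrite /of_digits size_mkseq.
have H k : \sum_(i < k) digit b n i * b ^ i = n %% b ^ k.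
  elim: k => [|k IH]; first by rewrite big_ord0 modn1.
  rewrite big_ord_recr /= IH /digit modn_divl expnS addnC.
  by rewrite [RHS](divn_eq _ (b ^ k)) (modn_dvdm n (dvdn_mull b (dvdnn _))).
transitivity (n %% b ^ ndigits b n); last first.
  by rewrite modn_small // /ndigits trunc_log_ltn.
by rewrite -H; apply: eq_bigr => i _; rewrite nth_mkseq.
Qed.

Definition dismal_mul (b m n : nat) : nat :=
  let k := ndigits b m in
  let l := ndigits b n in
  of_digits b
    (mkseq (fun i => \max_(j < k | (j <= i) && (i - j < l))
                       minn (digit b m j) (digit b n (i - j)))
           (k + l).-1).

Definition dismal_divides (b p n : nat) : Prop :=
  exists q : nat, dismal_mul b p q = n.

(* [fset_set] sends an infinite set to the empty one, so this is 0 when n has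
   infinitely many divisors, which happens only for n = 0. *)
Definition num_dismal_divisors (b n : nat) : nat :=
  #|` fset_set [set p : nat | dismal_divides b p n]%classic|.

Definition is_composition (k t : nat) (c : seq nat) : bool :=
  [&& size c == t, all (fun x => 0 < x) c & sumn c == k].

(* No part of a composition of k exceeds k, hence the entries in 'I_k.+1. *)
Definition num_first_max_compositions (k t : nat) : nat :=
  #|[pred c : t.-tuple 'I_k.+1 |
       let s := [seq nat_of_ord x | x <- c] in
       is_composition k t s && all (fun x => x <= head 0 s) s]|.

(* Main.v *)
Require Import Defs.
From mathcomp Require Import all_boot finmap zify.
From mathcomp Require Import classical_sets cardinality.

Set Implicit Arguments.
Unset Strict Implicit.
Unset Printing Implicit Defensive.

(** Write R_k for the number with k digits 1, and suppose that p times q is R_k.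
    Lowering every digit of q to at most 1 lowers every digit of the product to
    at most 1, and so keeps the product R_k; hence only the support of p
    matters.  If q has c digits then p has k - c + 1, and enlarging q to R_c can
    only help.  So p divides R_k exactly when, for some c > 0, p has no nonzero
    digit above position k - c and every position i < k has a nonzero digit of p
    among the positions i - c + 1, ..., i ([dismal_divides_repunitP]).

    Now write p with k digits, most significant first.  As its last digit is
    nonzero, this word splits uniquely into blocks 0 ... 0 e with e nonzero
    ([wordK], [parseK]), and the block lengths form a composition of k.  The
    support condition above says that no block is longer than c
    ([word_gapsP]) while the first one has length at least c: the first block is
    a longest one ([repunit_divisorP]).

    A divisor of R_k therefore is a composition of k whose first part is
    maximal, together with one digit in 1, ..., b - 1 for each part; with t
    parts there are (b - 1) ^ t choices of digits, which is the sum claimed. *)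

(** * Base b digits *)

Lemma of_digits_cons b x s : of_digits b (x :: s) = of_digits b s * b + x.
Proof.
rewrite /of_digits /= big_ord_recl /= expn0 muln1 addnC big_distrl /=.
by congr (_ + _); apply: eq_bigr => i _; rewrite /bump /= add1n expnSr mulnA.
Qed.

Lemma digit0 b n : digit b n 0 = n %% b.
Proof. by rewrite /digit expn0 divn1. Qed.

Lemma digitS b n i : digit b n i.+1 = digit b (n %/ b) i.
Proof. by rewrite /digit expnS divnMA. Qed.

Lemma digit_of_digits b s i :
  all (fun d => d < b) s -> digit b (of_digits b s) i = nth 0 s i.
Proof.
elim: s i => [|x s IHs] i /=.
  by move=> _; rewrite /of_digits big_ord0 /digit div0n mod0n nth_nil.
case/andP=> ltxb s_lt; rewrite of_digits_cons.
case: i => [|i]; first by rewrite digit0 modnMDl modn_small.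
have b_gt0 : 0 < b by apply: leq_ltn_trans ltxb.
by rewrite digitS divnMDl // divn_small // addn0 IHs.
Qed.

(** A number is recovered from its infinite digit expansion, so products can be
    compared digit by digit without tracking lengths. *)
Lemma digit_inj b m n : 1 < b -> digit b m =1 digit b n -> m = n.
Proof.
move=> b_gt1; have [N leN] := ubnP (m + n).
elim: N m n leN => // N IHN m n leN eq_mn.
have [/eqP|mn_gt0] := posnP (m + n); first by lia.
have eq_div : m %/ b = n %/ b.
  apply: IHN => [|i]; last by rewrite -!digitS.
  have := leq_div m b; have := leq_div n b.
  have := @ltn_Pdiv m b b_gt1; have := @ltn_Pdiv n b b_gt1; lia.
by rewrite (divn_eq m b) (divn_eq n b) eq_div -!digit0 eq_mn.
Qed.

Lemma digit_oversize b n i : 1 < b -> ndigits b n <= i -> digit b n i = 0.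
Proof.
move=> b_gt1 le_i; rewrite /digit divn_small ?mod0n //.
by apply: leq_trans (trunc_log_ltn n b_gt1) _; rewrite leq_exp2l.
Qed.

Lemma digit_lead_gt0 b n : 1 < b -> 0 < n -> 0 < digit b n (ndigits b n).-1.
Proof.
move=> b_gt1 n_gt0; have /andP[le_n lt_n] := trunc_log_bounds b_gt1 n_gt0.
rewrite /digit modn_small; first by rewrite divn_gt0 // expn_gt0 (ltnW b_gt1).
by rewrite ltn_divLR ?expn_gt0 ?(ltnW b_gt1) // -expnS.
Qed.

(** As digits past the length vanish, the bounds on the lengths of the factors
    can be dropped: the product is a plain max-min convolution of the infinite
    digit expansions. *)
Lemma digit_dismal_mul b m n i : 1 < b ->
  digit b (dismal_mul b m n) i =
    \max_(j < i.+1) minn (digit b m j) (digit b n (i - j)).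
Proof.
move=> b_gt1; have b_gt0 := ltnW b_gt1.
rewrite digit_of_digits; last first.
  apply/(all_nthP 0) => x; rewrite size_mkseq => ltx; rewrite nth_mkseq //.
  rewrite -[X in _ < X](prednK b_gt0) ltnS; apply/bigmax_leqP => j _.
  by rewrite geq_min -ltnS prednK // ltn_pmod.
have [lti|lei] := ltnP i (ndigits b m + ndigits b n).-1; last first.
  rewrite nth_default ?size_mkseq //; symmetry; apply/eqP; rewrite -leqn0.
  apply/bigmax_leqP => j _; rewrite geq_min.
  have [ltj|lej] := ltnP j (ndigits b m); last by rewrite digit_oversize.
  by rewrite [X in _ || (X <= _)]digit_oversize ?orbT //; lia.
rewrite nth_mkseq //; apply/eqP; rewrite eqn_leq; apply/andP; split.
  apply/bigmax_leqP => j /andP[leji _].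
  by apply: (bigmax_sup (Ordinal (leji : j < i.+1))).
apply/bigmax_leqP => j _.
have [ltj|lej] := ltnP j (ndigits b m); last first.
  by rewrite digit_oversize // min0n.
have [ltl|lel] := ltnP (i - j) (ndigits b n); last first.
  by rewrite [X in minn _ X]digit_oversize // minn0.
apply: (bigmax_sup (Ordinal ltj)) => //=.
by rewrite -ltnS ltn_ord.
Qed.

(** * Divisors of a repunit, by their support *)

Lemma digit_repunit b k i : 1 < b -> digit b (of_digits b (nseq k 1)) i = (i < k).
Proof.
move=> b_gt1; rewrite digit_of_digits ?all_nseq ?b_gt1 ?orbT // nth_nseq.
by case: ltnP.
Qed.

Lemma repunit_divn b k : 1 < b -> (b ^ k - 1) %/ (b - 1) = of_digits b (nseq k 1).
Proof.
move=> b_gt1; rewrite !subn1 predn_exp mulKn; last by lia.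
rewrite /of_digits size_nseq; apply: eq_bigr => i _.
by rewrite nth_nseq ltn_ord mul1n.
Qed.

(** Here c is the number of digits of the cofactor, and the repunit with c
    digits is the best cofactor of that length.  A nonzero digit of p at
    position j and the leading digit of the cofactor give a nonzero digit of the
    product at position j + c - 1, which must therefore be less than k. *)
Lemma dismal_divides_repunitP b k p : 1 < b -> 0 < k ->
  dismal_divides b p (of_digits b (nseq k 1)) <->
  exists2 c, 0 < c &
    (forall j, k < j + c -> digit b p j = 0) /\
    (forall i, i < k -> exists j, [/\ j <= i, i < j + c & digit b p j != 0]).
Proof.
move=> b_gt1 k_gt0; split=> [[q pq]|[c c_gt0 [p0 p1]]].
  have mulE i :
      \max_(j < i.+1) minn (digit b p j) (digit b q (i - j)) = (i < k).
    by rewrite -digit_dismal_mul // pq digit_repunit.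
  have supp i : i < k -> exists j,
      [/\ j <= i, digit b p j != 0 & digit b q (i - j) != 0].
    move=> ltik; have := mulE i; rewrite ltik.
    case: (@eq_bigmax _ (fun j : 'I_i.+1 =>
             minn (digit b p j) (digit b q (i - j)))); first by rewrite card_ord.
    by move=> j -> mj; exists j; split; have := ltn_ord j; lia.
  have q_gt0 : 0 < q.
    rewrite lt0n; apply/eqP => q0; have [j [_ _]] := supp _ k_gt0.
    by rewrite q0 /digit div0n mod0n.
  exists (ndigits b q) => //; split=> [j ltk|i /supp[j [leji pj qj]]].
    apply/eqP; rewrite -leqn0 leqNgt; apply/negP => pj.
    have [l lekl ql] : exists2 l, k <= j + l & 0 < digit b q l.
      exists (ndigits b q).-1; last exact: digit_lead_gt0.
      by rewrite /ndigits in ltk *; lia.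
    have lej : j < (j + l).+1 by rewrite ltnS leq_addr.
    have := @leq_bigmax _ (fun x : 'I_(j + l).+1 =>
      minn (digit b p x) (digit b q (j + l - x))) (Ordinal lej).
    by rewrite /= addKn mulE ltnNge lekl /=; lia.
  exists j; split=> //; rewrite ltnNge; apply: contra qj => leq.
  by rewrite digit_oversize //; lia.
exists (of_digits b (nseq c 1)); apply: (digit_inj b_gt1) => i.
rewrite digit_dismal_mul // digit_repunit //.
apply/eqP; rewrite eqn_leq; apply/andP; split.
  apply/bigmax_leqP => j _; rewrite digit_repunit //.
  have [ltijc|_] := ltnP (i - j) c; last by rewrite minn0.
  have [_|leki] := ltnP i k; first by rewrite geq_min leqnn orbT.
  by rewrite p0 ?min0n //; have := ltn_ord j; lia.
case: ltnP => // /p1[j [leji ltij pj]].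
apply: (bigmax_sup (Ordinal (leji : j < i.+1))) => //=.
by rewrite digit_repunit //; lia.
Qed.

(** * Words as concatenations of blocks 0 ... 0 e *)

(** The pair (a, e) stands for the block of length a that consists of a - 1
    zeros followed by the digit e; words are read most significant digit
    first. *)
Definition word (s : seq (nat * nat)) : seq nat :=
  flatten [seq rcons (nseq x.1.-1 0) x.2 | x <- s].

Definition extend_head (s : seq (nat * nat)) : seq (nat * nat) :=
  if s is (a, e) :: r then (a.+1, e) :: r else [::].

Definition parse (w : seq nat) : seq (nat * nat) :=
  foldr (fun d s => if d == 0 then extend_head s else (1, d) :: s) [::] w.

Definition block_ok (b : nat) (x : nat * nat) : bool :=
  [&& 0 < x.1, 0 < x.2 & x.2 < b].

(** The default value 1 of [last] lets the empty word through, which starts the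
    induction. *)
Lemma parseK b w : all (fun d => d < b) w -> last 1 w != 0 ->
  word (parse w) = w /\ all (block_ok b) (parse w).
Proof.
elim: w => [//|d w IHw] /= /andP[ltd w_lt] lastw.
have {IHw} [|wK ok] := IHw w_lt; first by case: (w) lastw.
case: eqP => [d0|/eqP d_neq0] /=; last first.
  by rewrite ok /block_ok /= ltd lt0n d_neq0 -[in RHS]wK.
subst d; move: wK ok lastw; case: (parse w) => [<- //|[[|a] e] r] //= <- /andP[oke ->].
by split; rewrite ?andbT.
Qed.

Lemma wordK b s : all (block_ok b) s -> parse (word s) = s.
Proof.
elim: s => [//|[[|a] e] s IHs] //= /andP[/and3P[/= _ e_gt0 _] /IHs {}IHs].
rewrite /word /= -/(word s) cat_rcons.
elim: a => [|a IHa] /=; last by rewrite IHa.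
by rewrite eqn0Ngt e_gt0 IHs.
Qed.

Lemma size_word b s : all (block_ok b) s -> size (word s) = sumn (unzip1 s).
Proof.
elim: s => [//|[[|a] e] s IHs] //= /andP[_ /IHs {}IHs].
by rewrite /word /= -/(word s) size_cat size_rcons size_nseq IHs.
Qed.

Lemma word_lt b s : all (block_ok b) s -> all (fun d => d < b) (word s).
Proof.
elim: s => [//|[a e] s IHs] //= /andP[/and3P[/= _ _ lteb] /IHs {}IHs].
rewrite /word /= -/(word s) all_cat all_rcons all_nseq lteb IHs /=.
by rewrite (leq_ltn_trans _ lteb) ?orbT.
Qed.

Lemma nth_word_cons a e s y : 0 < a -> nth 0 (word ((a, e) :: s)) y =
  if y < a then (if y.+1 == a then e else 0) else nth 0 (word s) (y - a).
Proof.
case: a => // a _.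
rewrite /word /= -/(word s) nth_cat size_rcons size_nseq nth_rcons size_nseq.
by rewrite nth_nseq eqSS ltnS leq_eqVlt; case: ltngtP.
Qed.

(** A window of length c that starts right after a nonzero digit (or at the
    beginning) meets another nonzero digit only if the block starting there has
    length at most c; windows starting inside a block meet its final digit even
    earlier. *)
Lemma word_gapsP b s c : all (block_ok b) s ->
  (forall x, x < size (word s) ->
     exists y, [/\ x <= y, y < x + c & nth 0 (word s) y != 0]) <->
  all (fun a => a <= c) (unzip1 s).
Proof.
elim: s => [|[a e] s IHs] //= /andP[oke oks].
have sz : size (word ((a, e) :: s)) = a + size (word s).
  by rewrite (@size_word b) /= ?oke ?oks // (size_word oks).
have /and3P[/= a_gt0 e_gt0 _] := oke.
split=> [gap|/andP[leac /(IHs oks) gap] x].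
  apply/andP; split.
    have [|y [_ ltyc]] := gap 0; first by rewrite sz ltn_addr.
    rewrite nth_word_cons //; case: ltnP; last by lia.
    by case: (y.+1 =P a) => //; lia.
  apply/(IHs oks) => x ltx; have [|y [lexy ltyc]] := gap (a + x).
    by rewrite sz ltn_add2l.
  rewrite nth_word_cons //; case: ltnP => [|leay]; first by lia.
  by exists (y - a); split => //; lia.
have [ltxa _|leax ltx] := ltnP x a.
  exists a.-1; rewrite nth_word_cons // prednK // leqnn eqxx; split; lia.
have [|y [lexy ltyc nz]] := gap (x - a); first by lia.
exists (a + y); split; [lia | lia |].
by rewrite nth_word_cons // addKn ltnNge leq_addr.
Qed.

(** * Divisors of a repunit, by their blocks *)

Definition first_max (s : seq nat) : bool := all (fun x => x <= head 0 s) s.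

(** Position j of p is position k - 1 - j of its word.  The vanishing of the
    digits of p above position k - c means that the first block has length at
    least c, and the gap condition bounds all blocks by c; so c has to be the
    length of the first block. *)
Lemma repunit_divisorP b k p : 1 < b -> 0 < k ->
  dismal_divides b p (of_digits b (nseq k 1)) <->
  exists s, [/\ all (block_ok b) s, sumn (unzip1 s) = k,
               first_max (unzip1 s) & p = of_digits b (rev (word s))].
Proof.
move=> b_gt1 k_gt0; rewrite dismal_divides_repunitP //; split.
  case=> c c_gt0 [p0 p1].
  set w := rev (mkseq (digit b p) k).
  have szw : size w = k by rewrite size_rev size_mkseq.
  have w_lt : all (fun d => d < b) w.
    rewrite all_rev; apply/(all_nthP 0) => i; rewrite size_mkseq => lti.
    by rewrite nth_mkseq // ltn_pmod // ltnW.
  have nthw x : x < k -> nth 0 w x = digit b p (k - x.+1).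
    by move=> ltx; rewrite nth_rev ?size_mkseq // nth_mkseq //; lia.
  have lastw : last 1 w != 0.
    rewrite (last_nth 0) szw -(prednK k_gt0) /= nthw ?prednK // subnn.
    by have [j [lej0 _]] := p1 _ k_gt0; have -> : j = 0 by lia.
  have [wK oks] := parseK w_lt lastw.
  have sums : sumn (unzip1 (parse w)) = k by rewrite -(size_word oks) wK.
  exists (parse w); split=> //; last first.
    rewrite wK revK; apply: (digit_inj b_gt1) => j.
    rewrite digit_of_digits; last by rewrite -all_rev.
    have [ltjk|lekj] := ltnP j k; first by rewrite nth_mkseq.
    by rewrite nth_default ?size_mkseq // p0 //; lia.
  have gaps : all (fun a => a <= c) (unzip1 (parse w)).
    apply/(word_gapsP _ oks); rewrite wK szw => x ltx.
    have [|j [leji ltij nz]] := p1 (k - x.+1); first by lia.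
    exists (k - j.+1); split; try lia.
    by rewrite nthw; [have -> : k - (k - j.+1).+1 = j by lia | lia].
  (* A shorter first block would end with a nonzero digit of p above k - c. *)
  suff le_c : c <= head 0 (unzip1 (parse w)).
    by apply: sub_all gaps => x; move=> /leq_trans; apply.
  move: oks sums wK; case: (parse w) => [|[a e] r] /=; first by lia.
  move=> /andP[/and3P[/= a_gt0 e_gt0 _] _] sums wK.
  rewrite leqNgt; apply/negP => ltac.
  have := nth_word_cons e r a.-1 a_gt0; rewrite wK prednK // leqnn eqxx.
  rewrite nthw; last by lia.
  by rewrite p0; lia.
case=> s [oks sums maxs ->]; move: (size_word oks); rewrite sums => szw.
have digE j : j < k ->
    digit b (of_digits b (rev (word s))) j = nth 0 (word s) (k - j.+1).
  by move=> ltj; rewrite digit_of_digits ?all_rev ?word_lt // nth_rev szw.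
have /(word_gapsP _ oks) gaps := maxs.
exists (head 0 (unzip1 s)).
  case: s oks sums {maxs digE szw gaps} => [|[a e] r] /=; first by lia.
  by case/andP=> /and3P[].
split=> [j ltk|i ltik].
  have [ltjk|lekj] := ltnP j k; last first.
    by rewrite digit_of_digits ?all_rev ?word_lt // nth_default // size_rev szw.
  rewrite digE //; move: oks sums ltk.
  case: (s) => [|[a e] r] /=; first by lia.
  case/andP=> /and3P[/= a_gt0 _ _] _ sums ltk.
  by rewrite nth_word_cons //; case: ltnP; [case: eqP|]; lia.
have [|y [lexy ltyc nz]] := gaps (k - i.+1); first by rewrite szw; lia.
have ltyk : y < k by rewrite ltnNge -szw; apply: contra nz => /(nth_default 0) ->.
exists (k - y.+1); split; try lia.
by rewrite digE; [have -> : k - (k - y.+1).+1 = y by lia | lia].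
Qed.

(** * Counting *)

Lemma of_digits_inj b s1 s2 :
  all (fun d => d < b) s1 -> all (fun d => d < b) s2 -> size s1 = size s2 ->
  of_digits b s1 = of_digits b s2 -> s1 = s2.
Proof.
move=> lt1 lt2 eq_sz eq12; apply: (@eq_from_nth _ 0) => // i _.
by rewrite -(digit_of_digits i lt1) eq12 digit_of_digits.
Qed.

(** Equal totals make the two words equally long, which excludes that they differ
    by leading zeros. *)
Lemma word_value_inj b s1 s2 : all (block_ok b) s1 -> all (block_ok b) s2 ->
  sumn (unzip1 s1) = sumn (unzip1 s2) ->
  of_digits b (rev (word s1)) = of_digits b (rev (word s2)) -> s1 = s2.
Proof.
move=> ok1 ok2 eq_sum eq12.
suff /(congr1 rev) : rev (word s1) = rev (word s2).
  by rewrite !revK => /(congr1 parse); rewrite (wordK ok1) (wordK ok2).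
apply: of_digits_inj eq12; rewrite ?all_rev ?(word_lt ok1) ?(word_lt ok2) //.
by rewrite !size_rev (size_word ok1) (size_word ok2).
Qed.

(** The parametrization also shows that D is finite, without which [fset_set D]
    would be empty. *)
Lemma card_fset_set_image (T : finType) (U : choiceType) (A : pred T) (f : T -> U)
    (D : set U) :
  {in A &, injective f} -> (forall u, D u <-> exists2 x, x \in A & u = f x) ->
  #|` fset_set D| = #|A|.
Proof.
move=> f_inj DE.
have -> : D = [set` [fset f x | x in A]%fset]%classic.
  apply/seteqP; split=> u /=.
    by move=> /DE[x Ax ->]; apply/imfsetP; exists x.
  by move=> /imfsetP[x /= Ax ->]; apply/DE; exists x.
by rewrite set_fsetK card_in_imfset //= cardE; congr size; rewrite -enum_finmemE.
Qed.

(** The index i : 'I_k stands for i + 1 parts, and an entry e : 'I_(b - 1) for the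
    nonzero digit e + 1; any choice of the digits is then legal and only the
    parts are constrained. *)
Definition runs_index (b k : nat) (i : 'I_k) : finType :=
  (i.+1.-tuple 'I_k.+1 * i.+1.-tuple 'I_(b - 1))%type.

Definition runs (b k : nat) (x : {i : 'I_k & runs_index b i}) : seq (nat * nat) :=
  zip [seq nat_of_ord a | a <- (tagged x).1]
      [seq (nat_of_ord e).+1 | e <- (tagged x).2].

Definition first_max_runs (b k : nat) : pred {i : 'I_k & runs_index b i} :=
  fun x => let c := [seq nat_of_ord a | a <- (tagged x).1] in
    is_composition k (tag x).+1 c && first_max c.

Lemma card_first_max_runs b k :
  #|@first_max_runs b k| =
    \sum_(1 <= t < k.+1) num_first_max_compositions k t * (b - 1) ^ t.
Proof.
rewrite big_add1 big_mkord -sum1_card.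
pose Q (i : 'I_k) : pred (runs_index b i) := fun y =>
  let c := [seq nat_of_ord a | a <- y.1] in
  is_composition k i.+1 c && first_max c.
rewrite (eq_bigl (fun p => predT (tag p) && Q (tag p) (tagged p))) //.
rewrite -(@sig_big_dep _ _ _ _ _ predT Q (fun _ _ => 1)) /=.
apply: eq_bigr => i _; rewrite sum1_card.
rewrite -[X in X ^ _]card_ord -card_tuple -cardX.
by apply: eq_card => y; rewrite !inE andbT.
Qed.

Lemma unzip1_runs b k x :
  unzip1 (@runs b k x) = [seq nat_of_ord a | a <- (tagged x).1].
Proof. by rewrite /runs unzip1_zip // !size_map !size_tuple. Qed.

Lemma unzip2_runs b k x :
  unzip2 (@runs b k x) = [seq (nat_of_ord e).+1 | e <- (tagged x).2].
Proof. by rewrite /runs unzip2_zip // !size_map !size_tuple. Qed.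

Lemma runs_inj b k : injective (@runs b k).
Proof.
move=> x y eq_xy; have := congr1 unzip1 eq_xy; have := congr1 unzip2 eq_xy.
rewrite !unzip1_runs !unzip2_runs; case: x y {eq_xy} => [i [c e]] [j [c' e']] /=.
move=> eq_e eq_c; have eq_ij : i = j.
  apply: val_inj; have := congr1 size eq_c; rewrite !size_map !size_tuple.
  by case.
subst j; have -> : c = c' by apply/val_inj/(inj_map (@ord_inj _)).
suff -> : e = e' by [].
by apply/val_inj; apply: inj_map eq_e => u v [/ord_inj].
Qed.

Lemma runs_ok b k x : @first_max_runs b k x -> all (block_ok b) (runs x).
Proof.
move=> /andP[/and3P[_ pos _] _].
apply/allP => -[a e] xae; apply/and3P; split=> /=.
- by apply: (allP pos); rewrite -unzip1_runs; apply: (map_f fst xae).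
- by have := map_f snd xae; rewrite -/(unzip2 _) unzip2_runs => /mapP[? _ /= ->].
have := map_f snd xae; rewrite -/(unzip2 _) unzip2_runs => /mapP[f _ /= ->].
by have := ltn_ord f; lia.
Qed.

(** The bounds built into the finite index type exclude nothing: the parts are
    positive with sum k, so there are at most k of them and each is at most k. *)
Lemma runs_surj b k s : 0 < k -> all (block_ok b) s -> sumn (unzip1 s) = k ->
  first_max (unzip1 s) -> exists2 x, x \in @first_max_runs b k & s = runs x.
Proof.
move=> k_gt0 oks sums maxs.
have pos : all (fun x => 0 < x) (unzip1 s).
  by rewrite all_map; apply: sub_all oks => -[a e] /and3P[].
have le_size : size s <= k.
  rewrite -sums -(size_map fst) -sum1_size sumnE big_seq [X in _ <= X]big_seq.
  by apply: leq_sum => a /(allP pos).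
have s_gt0 : 0 < size s by case: (s) sums => //=; lia.
have lti : (size s).-1 < k by rewrite prednK.
have szc : size [seq inord x.1 : 'I_k.+1 | x <- s] == (size s).-1.+1.
  by rewrite size_map prednK.
have lte x : x \in s -> x.2.-1 < b - 1.
  by case: x => a e /(allP oks)/and3P[/= _ e_gt0 lteb]; lia.
(* [insubd] needs a default digit; any entry of s shows that one exists. *)
have b1_gt0 : 0 < b - 1.
  by case: (s) s_gt0 lte => // y r _ /(_ y (mem_head _ _)); case: (b - 1).
have sze : size [seq insubd (Ordinal b1_gt0) x.2.-1 | x <- s] == (size s).-1.+1.
  by rewrite size_map prednK.
pose x : {i : 'I_k & runs_index b i} :=
  Tagged (runs_index b (k:=k)) (i := Ordinal lti) (Tuple szc, Tuple sze).
have cE : [seq nat_of_ord a | a <- (tagged x).1] = unzip1 s.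
  rewrite /= -map_comp; apply/eq_in_map => y ys /=; rewrite inordK // ltnS -sums.
  by rewrite sumnE big_map (big_rem y ys) leq_addr.
have eE : [seq (nat_of_ord e).+1 | e <- (tagged x).2] = unzip2 s.
  rewrite /= -map_comp; apply/eq_in_map => y ys /=.
  rewrite val_insubd (lte _ ys) prednK //.
  by have /and3P[] := allP oks _ ys.
exists x; last by rewrite /runs cE eE zip_unzip.
rewrite unfold_in /first_max_runs cE maxs /is_composition size_map prednK //.
by rewrite pos sums !eqxx.
Qed.

Theorem theorem13 (b k : nat) (hb : 2 <= b) (hk : 1 <= k) :
  num_dismal_divisors b ((b ^ k - 1) %/ (b - 1)) =
    num_dismal_divisors b (of_digits b (nseq k 1)) /\
  num_dismal_divisors b (of_digits b (nseq k 1)) =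
    \sum_(1 <= t < k.+1) num_first_max_compositions k t * (b - 1) ^ t.
Proof.
split; first by rewrite repunit_divn.
have sum_runs x : x \in @first_max_runs b k -> sumn (unzip1 (runs x)) = k.
  by rewrite unzip1_runs => /andP[/and3P[_ _ /eqP]].
rewrite -card_first_max_runs /num_dismal_divisors.
apply: (@card_fset_set_image _ _ _ (fun x => of_digits b (rev (word (runs x))))).
  move=> x y Ax Ay /word_value_inj eq_xy; apply: runs_inj.
  by apply: eq_xy; rewrite ?sum_runs //; apply: runs_ok.
move=> p /=; rewrite repunit_divisorP //; split.
  move=> [s [oks sums maxs ->]].
  by have [x Ax ->] := runs_surj hk oks sums maxs; exists x.
move=> [x Ax ->]; exists (runs x); split=> //; first exact: runs_ok Ax.
  exact: sum_runs.
by rewrite unzip1_runs; case/andP: Ax.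
Qed.
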